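(* For integers $k\ge-1$ define the differential operators $$V_k=-\frac12\sum_{\mathbf L\in N^\infty}(2(|\mathbf L|+k)+3)!!\,\gamma_{\mathbf L}\mathbf s^{\mathbf L}\frac{\partial}{\partial t_{|\mathbf L|+k+1}}+\frac12\sum_{j=0}^\infty\frac{(2(j+k)+1)!!}{(2j-1)!!}t_j\frac{\partial}{\partial t_{j+k}}$$ $$+\frac14\sum_{\substack{d_1+d_2=k-1\\ d_1,d_2\ge0}}(2d_1+1)!!(2d_2+1)!!\frac{\partial^2}{\partial t_{d_1}\partial t_{d_2}}+\frac{\delta_{k,-1}t_0^2}{4}+\frac{\delta_{k,0}}{16},\qquad \gamma_{\mathbf L}=\frac{(-1)^{\|\mathbf L\|}}{\mathbf L!\,(2|\mathbf L|+1)!!}.$$ Then the operators $V_k$, $k\ge-1$, satisfy the Virasoro relations $$[V_n,V_m]=(n-m)V_{n+m}\qquad (n,m\ge-1)$$ (the right-hand side being $0$ when $n=m$).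
   Context: $N^\infty$ is the semigroup of sequences $\mathbf m=(m(1),m(2),\dots)$ of nonnegative integers with $m(i)=0$ for $i$ sufficiently large; $|\mathbf m|=\sum_{i\ge1} i\,m(i)$, $\|\mathbf m\|=\sum_{i\ge1} m(i)$, $\mathbf m!=\prod_{i\ge1} m(i)!$. $\mathbf s=(s_1,s_2,\dots)$ and $\mathbf t=(t_0,t_1,t_2,\dots)$ are formal variables, $\mathbf s^{\mathbf m}=\prod_{i\ge1}s_i^{m(i)}$; the operators act on formal power series in $\mathbf s,\mathbf t$. Conventions: $(-1)!!=1$, $\partial/\partial t_{-1}=0$, $\delta_{i,j}$ is the Kronecker delta. *)

(* Defs.v *)
From mathcomp Require Import all_boot all_order all_algebra finmap.
From mathcomp Require Import monalg.
From mathcomp Require Import boolp classical_sets functions cardinality fsbigop.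

Set Implicit Arguments.
Unset Strict Implicit.
Unset Printing Implicit Defensive.

Import Order.TTheory GRing.Theory Num.Theory.

Local Open Scope classical_set_scope.
Local Open Scope ring_scope.

Definition posnat := {i : nat | (0 < i)%N}.

(* $N^\infty$: finitely supported functions from the positive integers to the
   natural numbers. *)
Notation Ninf := {cmonom posnat}.

(* |m|, ||m|| and m!; all indices outside [finsupp m] contribute trivially. *)
Definition weight (m : Ninf) : nat := (\sum_(i <- finsupp m) val i * m i)%N.
Definition len (m : Ninf) : nat := (\sum_(i <- finsupp m) m i)%N.
Definition mfact (m : Ninf) : nat := (\prod_(i <- finsupp m) (m i)`!)%N.

Fixpoint dfact_nat (n : nat) : nat :=
  if n is n'.+2 then (n * dfact_nat n')%N else 1%N.

(* z!!, extended by the convention (-1)!! = 1.  (The value at z < -1 is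
   immaterial.) *)
Definition dfact (z : int) : nat := if z is Posz n then dfact_nat n else 1%N.

(* The pair (a, b) encodes the monomial s^a t^b; the variables t_j are indexed
   by j >= 0, the variables s_i by i >= 1. *)
Definition monom : choiceType := (Ninf * {cmonom nat})%type.

Definition monom_mul (u v : monom) : monom :=
  (mmul u.1 v.1, mmul u.2 v.2).

(* F[[s, t]]: a formal power series is the family of its coefficients, and a
   series may involve infinitely many of the variables. *)
Definition fps (F : fieldType) := monom -> F^o.

Section FormalPowerSeries.
Variable F : fieldType.
Implicit Types (f g : fps F).

Definition fps_monom (u : monom) : fps F := fun v => (v == u)%:R.

Definition spow (L : Ninf) : fps F := fps_monom (L, mone).
Definition tvar (j : nat) : fps F := fps_monom (mone, ucm j).

(* The Cauchy product.  The name is needed because [f * g] would be the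
   pointwise product of coefficients. *)
Definition fps_mul f g : fps F := fun u =>
  \sum_(p \in [set p : monom * monom | monom_mul p.1 p.2 = u]) f p.1 * g p.2.

(* Sum of a family of series, coefficient by coefficient.  It is meaningful for
   families in which each monomial has a nonzero coefficient in only finitely
   many members, which [finite_L_family] and [finite_t_family] below establish
   for the infinite sums occurring in [V]. *)
Definition fps_sum (I : choiceType) (A : set I) (u : I -> fps F) : fps F :=
  fun v => \sum_(i \in A) u i v.

Definition partial_t_nat (j : nat) f : fps F :=
  fun u => (u.2 j).+1%:R * f (monom_mul u (mone, ucm j)).

(* d/dt_i, extended by the convention d/dt_{-1} = 0. *)
Definition partial_t (i : int) f : fps F :=
  if i is Posz j then partial_t_nat j f else 0.

Definition gamma (L : Ninf) : F :=
  (-1) ^+ len L / (mfact L * dfact (2 * (weight L)%:Z + 1))%:R.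

Definition V (k : int) f : fps F :=
  - (2^-1 *: fps_sum [set: Ninf] (fun L =>
       ((dfact (2 * ((weight L)%:Z + k) + 3))%:R * gamma L)
         *: fps_mul (spow L) (partial_t ((weight L)%:Z + k + 1) f)))
  + 2^-1 *: fps_sum [set: nat] (fun j =>
       ((dfact (2 * (j%:Z + k) + 1))%:R / (dfact (2 * j%:Z - 1))%:R)
         *: fps_mul (tvar j) (partial_t (j%:Z + k) f))
  + 4^-1 *: fps_sum [set d : nat * nat | d.1%:Z + d.2%:Z = k - 1] (fun d =>
       (dfact (2 * d.1%:Z + 1) * dfact (2 * d.2%:Z + 1))%:R
         *: partial_t d.1%:Z (partial_t d.2%:Z f))
  + ((k == -1)%:R / 4) *: fps_mul (fps_mul (tvar 0) (tvar 0)) f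
  + ((k == 0)%:R / 16) *: f.

End FormalPowerSeries.

Arguments V F k f : clear implicits.

(* The sums in [fps_mul], and the infinite sums over L and j in [V], have only
   finitely many nonzero terms in each coefficient, so that [\sum_(_ \in _)]
   does not take its default value 0 there. *)

Lemma finite_divisors (I : choiceType) (a : {cmonom I}) :
  finite_set [set b : {cmonom I} | exists c, mmul b c = a].
Proof.
pose n := (\sum_(i <- finsupp a) a i)%N.
pose g (h : {ffun finsupp a -> 'I_n.+1}) : {cmonom I} :=
  mkcmonom [fsfun i : finsupp a => nat_of_ord (h i) | 0%N].
apply: (@sub_finite_set _ _ (g @` setT)); last first.
  exact/finite_image/finite_finset.
move=> b /= [c bc].
have le_ba i : (b i <= a i)%N by rewrite -bc cmM leq_addr.
have le_an i : (a i <= n)%N.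
  case: (finsuppP a i) => // ia.
  by rewrite /n (big_fsetD1 i) //= leq_addr.
pose h := [ffun i : finsupp a => inord (b (val i)) : 'I_n.+1].
have hE i : h i = b (val i) :> nat.
  by rewrite ffunE inordK // ltnS (leq_trans (le_ba _)).
exists h => //.
apply/eqP/cmP => i; rewrite /g cmE /= fsfun_ffun.
case: insubP => [j _ <-|]; last first.
  by rewrite -cmE_eq0 => /eqP ai0; move: (le_ba i); rewrite ai0 leqn0 => /eqP.
exact: hE.
Qed.

Lemma finite_fps_mul (u : monom) :
  finite_set [set p : monom * monom | monom_mul p.1 p.2 = u].
Proof.
pose D1 := [set b | exists c, mmul b c = u.1].
pose D2 := [set b | exists c, mmul b c = u.2].
apply: (@sub_finite_set _ _ ((D1 `*` D2) `*` (D1 `*` D2))); last first.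
  by do 2!apply: finite_setX; exact: finite_divisors.
move=> [[a b] [c d]] /= pu; rewrite /D1 /D2 -pu; split; split=> /=.
- by exists c.
- by exists d.
- by exists a; rewrite mulmC.
- by exists b; rewrite mulmC.
Qed.

Lemma fps_mul_monom_neq0 (F : fieldType) (v u : monom) (f : fps F) :
  fps_mul (fps_monom F v) f u != 0 -> exists w, monom_mul v w = u.
Proof.
apply: contra_neqP => nvu; rewrite /fps_mul fsbig1 // => -[p q] /= pq.
rewrite /fps_monom; case: eqP => [pv|]; last by rewrite mul0r.
by case: nvu; exists q; rewrite -pv.
Qed.

Lemma finite_L_family (F : fieldType) (c : Ninf -> F) (g : Ninf -> fps F)
    (u : monom) :
  finite_set [set L | (c L *: fps_mul (spow F L) (g L)) u != 0].
Proof.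
apply: (sub_finite_set _ (finite_divisors u.1)) => L /=.
rewrite scalrfctE scaler_eq0 negb_or => /andP[_].
by move=> /fps_mul_monom_neq0 [w <-]; exists w.1.
Qed.

Lemma finite_t_family (F : fieldType) (c : nat -> F) (g : nat -> fps F)
    (u : monom) :
  finite_set [set j | (c j *: fps_mul (tvar F j) (g j)) u != 0].
Proof.
apply: (sub_finite_set _ (finite_fset (finsupp u.2))) => j /=.
rewrite scalrfctE scaler_eq0 negb_or => /andP[_].
move=> /fps_mul_monom_neq0 [w <-] /=.
by rewrite -cmE_neq0 cmM cmUU.
Qed.

(* Main.v *)
Require Import Defs.
From mathcomp Require Import all_boot all_order all_algebra finmap.
From mathcomp Require Import monalg.
From mathcomp Require Import boolp classical_sets functions cardinality fsbigop.
From HB Require Import structures.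
From mathcomp Require Import zify ring.

Set Implicit Arguments.
Unset Strict Implicit.
Unset Printing Implicit Defensive.

Import Order.TTheory GRing.Theory Num.Theory.

Local Open Scope ring_scope.

(** With alpha_(2i+1) = (2i+1)!! d/dt_i and alpha_(-2j-1) = t_j / (2j-1)!!, one
has [alpha_a, alpha_b] = a delta_(a+b,0): these are the modes of a twisted free
boson.  Since (2(|L|+k)+3)!! gamma_L is (2(j+k)+1)!! / (2j-1)!! times
(-1)^||L|| / L! for j = |L|+1, the sum over L in V_k is absorbed into the sum
over j by the translation of t_j by the sum of the (-1)^||L|| s^L / L! over
|L| = j-1.  The s_i commute with all modes, so the translation preserves the
brackets, and V_k is 1/4 of the sum of the normally ordered products
alpha_a alpha_b over odd a, b with a + b = 2k, plus delta_(k,0)/16.  Such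
operators form a Virasoro algebra; the constant 1/16 absorbs the value at
n = 1, m = -1 that normal ordering produces.

The sums are infinite, so V_n V_m is not expanded as it stands.  The proof
uses instead the bracket with a single mode,
[alpha_(2q-1), V_k] = (2q-1)/2 alpha_(2(q+k)-1) ([alpha_vir]).  By the Jacobi
identity, the difference between the two sides of the Virasoro relation commutes
with every d/dt_i ([alphaS_defect]).  In characteristic 0, the coefficients of
a series are obtained from its t-derivatives at t = 0, so it is enough that
this difference vanishes at t = 0 on every series ([defect_eq0]).

At t = 0 every term of V_k with a factor t_j disappears.  What remains,
[vir_tfree], is a combination of s^L and of the derivations d/dt_i, and two such
operators commute.  Hence, in V_n V_m f at t = 0, only the terms created by
moving the derivations of V_n through V_m contribute to the commutator.  The sum
over L yields n - m at once.  The second-order part yields a convolution of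
modes with weights, whose antisymmetrization in n and m is n - m times the plain
convolution ([shifted_convo_antisym]); when m = -1 the mode alpha_(-1) = t_0
occurs and produces the central term ([shifted_convo0]).

Throughout, nat indices are used: [vir p] is V_(p-1) and [alpha q] is
alpha_(2q-1), so that all modes needed, t_0 included, are [alpha q] with
q >= 0. *)

(** * A convolution identity *)

Section WeightedConvolution.
Variables (F : fieldType) (G : nat -> nat -> F).

Definition convo N : F := \sum_(1 <= i < N) G i (N - i).

(** This is what the second-order part of V_(p-1) produces when its two modes
are moved through V_(r-1), with [G i j] standing for the product of the modes
[alpha i] and [alpha j]. *)
Definition shifted_convo p r : F := \sum_(1 <= i < p)
  ((2 * i%:R - 1) * G (i + r).-1 (p - i)
   + (2 * (p - i)%:R - 1) * G i (p - i + r).-1).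

Hypothesis G_sym : forall i j, (0 < i)%N -> (0 < j)%N -> G i j = G j i.

Lemma sum_rev_pos N (H : nat -> nat -> F) :
  \sum_(1 <= i < N) H i (N - i)%N = \sum_(1 <= i < N) H (N - i)%N i.
Proof.
rewrite big_nat_rev /=; apply: eq_big_nat => i /andP[i1 iN].
by congr H; lia.
Qed.

Lemma shifted_convoE p r : (0 < r)%N ->
  shifted_convo p r
  = 2 * \sum_(1 <= i < p) (2 * i%:R - 1) * G (i + r).-1 (p - i).
Proof.
move=> r0; rewrite /shifted_convo big_split /= mulr2n mulrDl mul1r.
congr (_ + _).
rewrite (sum_rev_pos _ (fun i j => (2 * j%:R - 1) * G i (j + r).-1)).
by apply: eq_big_nat => i /andP[i1 ip]; rewrite G_sym //; lia.
Qed.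

(** The symmetry of [G] merges the two terms of each sum, and
both sums then carry the same affine weight [c], the first on [i < p] and the
second, after a sign change, on [p <= i]: they fit together into one sum over
all of [1 <= i < p + r - 1].  Averaging with the reversed sum makes the weight
constant. *)
Lemma shifted_convo_antisym p r : (0 < p)%N -> (0 < r)%N ->
  shifted_convo p r - shifted_convo r p
  = 2 * (p%:R - r%:R) * convo (p + r).-1.
Proof.
move=> p0 r0; rewrite !shifted_convoE //; set N := (p + r).-1.
pose c i : F := 2 * (p%:R - i%:R) - 1.
have -> : \sum_(1 <= i < p) (2 * i%:R - 1) * G (i + r).-1 (p - i)
        = \sum_(1 <= i < p) c i * G i (N - i).
  rewrite -(sum_rev_pos _ (fun j i => (2 * i%:R - 1) * G (i + r).-1 j)).
  apply: eq_big_nat => i /andP[i1 ip]; rewrite /c -natrB ?(ltnW ip) //.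
  rewrite G_sym; [|lia|lia]; congr (_ * G _ _); rewrite /N; lia.
have -> : \sum_(1 <= i < r) (2 * i%:R - 1) * G (i + p).-1 (r - i)
        = - \sum_(p <= i < N) c i * G i (N - i).
  have -> : \sum_(p <= i < N) c i * G i (N - i)
          = \sum_(1 + p.-1 <= i < N) c i * G i (N - i) by rewrite add1n prednK.
  rewrite big_addn.
  have -> : (N - p.-1 = r)%N by rewrite /N; lia.
  rewrite -sumrN; apply: eq_big_nat => i /andP[i1 ir]; rewrite -mulNr.
  congr (_ * G _ _); [|lia|rewrite /N; lia].
  have -> : (i + p.-1 = i + p - 1)%N by lia.
  by rewrite /c natrB ?natrD; [ring|lia].
rewrite mulrN opprK -mulrDr -big_cat_nat //=; last by rewrite /N; lia.
rewrite [LHS]mulr_natl mulr2n.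
rewrite [X in _ + X](sum_rev_pos _ (fun i j => c i * G i j)) -big_split /=.
rewrite mulr_sumr; apply: eq_big_nat => i /andP[i1 iN].
rewrite (@G_sym (N - i)%N i); [|lia|lia].
have pr : N%:R = p%:R + r%:R - 1 :> F.
  by apply/(canRL (addrK 1)); rewrite -natrD natr1 prednK // addn_gt0 p0.
by rewrite /c natrB ?(ltnW iN) // pr; ring.
Qed.

(** For [r = 0] the index of one factor can drop to 0, where [G] is no longer
symmetric: the value [G 1 0 = x] comes from [alpha 1] hitting [t_0]. *)
Lemma shifted_convo0 p (x : F) : (0 < p)%N ->
    (forall j, G 0 j = 0) ->
    (forall i, (0 < i)%N -> G i 0%N = (i == 1%N)%:R * x) ->
  shifted_convo p 0 = 2 * p%:R * convo p.-1 + (p == 2%N)%:R * x.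
Proof.
case: p => // p _ G0 G1; rewrite /shifted_convo big_split /= /convo.
have [->|p0] := posnP p; first by rewrite !big_geq // mul0r mulr0 !addr0.
rewrite big_ltn // addn0 G0 mulr0 add0r big_add1 /=.
rewrite [X in _ + X]big_nat_recr //= addn0 subSnn G1 // eqSS.
rewrite addrA -big_split /= mulr_sumr; congr (_ + _); last by ring.
apply: eq_big_nat => i /andP[i1 ip].
rewrite !addn0 /= subSS subSn ?(ltnW ip) //=.
rewrite -[(p - i).+1%:R]natr1 natrB ?(ltnW ip) //.
by rewrite -!natr1; ring.
Qed.

End WeightedConvolution.

(** * Multiplication by monomials and differentiation *)

Section Operators.
Variable F : fieldType.
Implicit Types (f g : fps F) (u v w : monom) (L : Ninf).

Lemma fpsDE f g u : (f + g) u = f u + g u :> F. Proof. by []. Qed.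
Lemma fpsNE f u : (- f) u = - f u :> F. Proof. by []. Qed.
Lemma fpsZE (c : F) f u : (c *: f) u = c * f u :> F. Proof. by []. Qed.

Lemma monom_mulA : associative monom_mul.
Proof. by move=> u v w; rewrite /monom_mul /= !mulmA. Qed.

Lemma monom_mulC : commutative monom_mul.
Proof. by move=> u v; rewrite /monom_mul mulmC [mmul u.2 _]mulmC. Qed.

Lemma cmonomP (I : choiceType) (a b : {cmonom I}) :
  (forall i, a i = b i) -> a = b.
Proof. by move=> ab; apply/eqP/cmP. Qed.

Lemma mmul_inj (I : choiceType) (a : {cmonom I}) : injective (mmul a).
Proof.
move=> b c abc; apply: cmonomP => i; apply: (@addnI (a i)).
by rewrite -!cmM abc.
Qed.

Lemma monom_mul_inj v : injective (monom_mul v).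
Proof. by move=> [a b] [c d] /= [/mmul_inj -> /mmul_inj ->]. Qed.

(** Together with [fps_mul_monom_eq0], this determines multiplication by a
monomial as a shift of coefficients, which avoids division of monomials. *)
Lemma fps_mul_monomE v f w : fps_mul (fps_monom F v) f (monom_mul v w) = f w.
Proof.
rewrite /fps_mul -(@fsbig_widen _ _ _ _ [set (v, w)]%classic).
- by rewrite fsbig_set1 /fps_monom eqxx mul1r.
- by move=> p /= ->.
move=> [p q] /= [pq] /=; rewrite /fps_monom.
have [pv|] := eqVneq p v; last by rewrite mul0r.
by move: pq; rewrite pv => /monom_mul_inj -> /(_ erefl).
Qed.

Lemma fps_mul_monom_eq0 v f u : ~ (exists w, monom_mul v w = u) ->
  fps_mul (fps_monom F v) f u = 0.
Proof.
by move=> nvu; apply/eqP; apply: contra_notT nvu => /fps_mul_monom_neq0.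
Qed.

Lemma fps_mul_is_linear f : linear (fps_mul f).
Proof.
move=> c g h; apply/funext => u.
rewrite fpsDE fpsZE /fps_mul !(fsbig_finite _ _ (finite_fps_mul u)).
rewrite mulr_sumr -big_split; apply: eq_bigr => p _ /=.
by rewrite fpsDE fpsZE; ring.
Qed.
HB.instance Definition _ f :=
  GRing.isLinear.Build F (fps F) (fps F) _ (fps_mul f) (fps_mul_is_linear f).

Lemma fps_mulD f g h : fps_mul f (g + h) = fps_mul f g + fps_mul f h.
Proof. exact: linearD. Qed.

Lemma fps_mulZ (c : F) f g : fps_mul f (c *: g) = c *: fps_mul f g.
Proof. exact: linearZ. Qed.

Lemma partial_t_nat_is_linear i : linear (@partial_t_nat F i).
Proof.
move=> c g h; apply/funext => u.
by rewrite fpsDE fpsZE /partial_t_nat fpsDE fpsZE; ring.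
Qed.
HB.instance Definition _ i :=
  GRing.isLinear.Build F (fps F) (fps F) _ (@partial_t_nat F i)
    (partial_t_nat_is_linear i).

Lemma partial_tZ i (c : F) f :
  partial_t_nat i (c *: f) = c *: partial_t_nat i f.
Proof. exact: linearZ. Qed.

Lemma fps_monom_mulA v w f :
  fps_mul (fps_monom F v) (fps_mul (fps_monom F w) f) =
  fps_mul (fps_monom F (monom_mul v w)) f.
Proof.
apply/funext => u.
have [[x <-]|nvu] := pselect (exists x, monom_mul v x = u); last first.
  rewrite !fps_mul_monom_eq0 // => -[x xu]; apply: nvu.
  by exists (monom_mul w x); rewrite monom_mulA.
rewrite fps_mul_monomE.
have [[y <-]|nwx] := pselect (exists y, monom_mul w y = x).
  by rewrite monom_mulA !fps_mul_monomE.
rewrite !fps_mul_monom_eq0 // => -[y]; rewrite -monom_mulA => /monom_mul_inj yx.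
by apply: nwx; exists y.
Qed.

Lemma fps_monom_mulC v w f :
  fps_mul (fps_monom F v) (fps_mul (fps_monom F w) f) =
  fps_mul (fps_monom F w) (fps_mul (fps_monom F v) f).
Proof. by rewrite !fps_monom_mulA monom_mulC. Qed.

Lemma fps_monomM v w :
  fps_mul (fps_monom F v) (fps_monom F w) = fps_monom F (monom_mul v w).
Proof.
apply/funext => u.
have [[x <-]|nvu] := pselect (exists x, monom_mul v x = u).
  by rewrite fps_mul_monomE /fps_monom (inj_eq (@monom_mul_inj v)).
rewrite fps_mul_monom_eq0 // /fps_monom.
by case: eqP => // uvw; case: nvu; exists w.
Qed.

Lemma partial_tC i j f :
  partial_t_nat i (partial_t_nat j f) = partial_t_nat j (partial_t_nat i f).
Proof.
have [->//|ij] := eqVneq i j.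
apply/funext => u; rewrite /partial_t_nat !cmM !cmU mulrCA -!monom_mulA.
rewrite [monom_mul (mone, ucm i) _]monom_mulC (negbTE ij).
by rewrite eq_sym (negbTE ij) !addn0.
Qed.

Lemma partial_t_spow i L f :
  partial_t_nat i (fps_mul (spow F L) f) =
  fps_mul (spow F L) (partial_t_nat i f).
Proof.
apply/funext => u; rewrite /partial_t_nat.
have [[w <-]|nLu] := pselect (exists w, monom_mul (L, mone) w = u).
  by rewrite -monom_mulA !fps_mul_monomE cmM cm1.
rewrite !fps_mul_monom_eq0 ?mulr0 // => -[w wu]; apply: nLu.
exists (w.1, u.2); apply/esym/eqP.
rewrite -pair_eqE /pair_eq /= mul1m eqxx andbT.
by move: wu => /(congr1 fst) /= ->; rewrite mulm1.
Qed.

Lemma partial_t_tvar i j f :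
  partial_t_nat i (fps_mul (tvar F j) f) =
  fps_mul (tvar F j) (partial_t_nat i f) + (i == j)%:R *: f.
Proof.
apply/funext => u; rewrite fpsDE fpsZE /partial_t_nat.
have [[w <-]|nju] := pselect (exists w, monom_mul (mone, ucm j) w = u).
  rewrite -monom_mulA !fps_mul_monomE cmM cmU.
  have [->|_] := eqVneq i j; rewrite ?eqxx; last by rewrite mul0r addr0.
  by rewrite monom_mulC mul1r add1n -natr1 mulrDl mul1r.
rewrite [X in _ = X + _]fps_mul_monom_eq0 // add0r.
(* No factor t_j can be split off u, so the exponent of t_j in u is 0. *)
have uj : u.2 j = 0%N.
  apply: contrapT => uj; apply: nju; exists (u.1, divcm u.2 (ucm j)).
  rewrite [RHS]surjective_pairing; congr pair => /=; first by rewrite mul1m.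
  apply: cmonomP => k; rewrite cmM cmU.
  move/eqP: uj; rewrite -lt0n => uj; rewrite divcmE cmU.
  have [<-|_] := eqVneq j k; last by rewrite subn0.
  by rewrite subnKC.
have [->|ij] := eqVneq i j.
  by rewrite monom_mulC fps_mul_monomE uj.
rewrite mul0r fps_mul_monom_eq0 ?mulr0 // => -[w].
move=> /(congr1 (fun m : monom => m.2 j)) /=; rewrite !cmM !cmU uj eqxx.
by rewrite (negbTE ij).
Qed.

End Operators.

(** * Modes *)

Local Arguments dfact_nat : simpl never.

Section Virasoro.
Variable F : fieldType.
Implicit Types (f g : fps F) (u v w : monom) (L : Ninf) (T : fps F -> fps F).

(** The boson mode alpha_(2q-1): a rescaled derivation for [q > 0], and
multiplication by [t_0] for [q = 0]. *)
Definition alpha (q : nat) f : fps F :=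
  if q is i.+1 then (dfact_nat (2 * i).+1)%:R *: partial_t_nat i f
  else fps_mul (tvar F 0) f.

Lemma alpha_is_linear q : linear (alpha q).
Proof.
case: q => [|i] c f g /=; first exact: linearP.
by rewrite linearP scalerDr !scalerA mulrC.
Qed.
HB.instance Definition _ q :=
  GRing.isLinear.Build F (fps F) (fps F) _ (alpha q) (alpha_is_linear q).

Lemma alphaD q f g : alpha q (f + g) = alpha q f + alpha q g.
Proof. exact: linearD. Qed.

Lemma alphaN q f : alpha q (- f) = - alpha q f.
Proof. exact: linearN. Qed.

Lemma alphaZ q (c : F) f : alpha q (c *: f) = c *: alpha q f.
Proof. exact: linearZ. Qed.

Definition alphaE := (alphaD, alphaN, alphaZ).

Lemma alpha_spow q L f :
  alpha q (fps_mul (spow F L) f) = fps_mul (spow F L) (alpha q f).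
Proof.
case: q => [|i] /=; first exact: fps_monom_mulC.
by rewrite partial_t_spow linearZ.
Qed.

Lemma alpha_tvar q j f : alpha q (fps_mul (tvar F j) f) =
  fps_mul (tvar F j) (alpha q f)
  + ((q == j.+1)%:R * (dfact_nat (2 * j).+1)%:R) *: f.
Proof.
case: q => [|i] /=.
  by rewrite mul0r scale0r addr0; exact: fps_monom_mulC.
rewrite partial_t_tvar scalerDr scalerA eqSS [in RHS]linearZ.
congr (_ + _ *: _).
by have [->|_] := eqVneq i j; rewrite ?mulr0 ?mul0r // mulrC.
Qed.

Lemma alphaS0 q f :
  alpha q.+1 (alpha 0 f) = alpha 0 (alpha q.+1 f) + (q == 0%N)%:R *: f.
Proof.
rewrite [alpha 0]/alpha alpha_tvar eqSS; congr (_ + _ *: _).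
by case: eqP => _; rewrite ?mul0r ?mul1r.
Qed.

Lemma alphaC q r f : alpha q (alpha r f) = alpha r (alpha q f)
  + (((q == 1%N) && (r == 0%N))%:R - ((q == 0%N) && (r == 1%N))%:R) *: f.
Proof.
case: q r => [|i] [|j].
- by rewrite subr0 scale0r addr0.
- by rewrite alphaS0 /= sub0r eqSS scaleNr addrK.
- by rewrite alphaS0 /= subr0 eqSS andbT.
by rewrite /= !andbF subr0 scale0r addr0 !linearZ /= !scalerA partial_tC mulrC.
Qed.

Lemma alphaSC q r f : alpha q.+1 (alpha r.+1 f) = alpha r.+1 (alpha q.+1 f).
Proof. by rewrite alphaC andbF subr0 scale0r addr0. Qed.

Local Arguments alpha : simpl never.

(** An operator of this form can be moved inside a coefficientwise sum over the
exponents [L] or over [j].  The condition on the s-part makes the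
same finite set of [L] serve for [u] and [v]. *)
Definition single_term T := forall u, exists (c : F) v,
  u.1 = v.1 /\ forall f, T f u = c * f v.

Lemma alpha_single_term q : single_term (alpha q).
Proof.
case: q => [|i] u; last first.
  exists ((dfact_nat (2 * i).+1)%:R * (u.2 i).+1%:R).
  exists (monom_mul u (mone, ucm i)).
  by split=> [|f]; rewrite /= ?mulm1 // /alpha /= fpsZE /partial_t_nat mulrA.
have [[w <-]|ntu] := pselect (exists w, monom_mul (mone, ucm 0%N) w = u).
  exists 1, w; split=> [|f]; first by rewrite /= mul1m.
  by rewrite /alpha fps_mul_monomE mul1r.
by exists 0, u; split=> // f; rewrite mul0r /alpha /= fps_mul_monom_eq0.
Qed.

(** * The sum over L *)

Definition divisors_of (I : choiceType) (a : {cmonom I}) : {fset {cmonom I}} :=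
  fset_set [set b | exists c, mmul b c = a]%classic.

Lemma in_divisors_of (I : choiceType) (a b : {cmonom I}) :
  (b \in divisors_of a) <-> exists c, mmul b c = a.
Proof.
rewrite /divisors_of in_fset_set; last exact: finite_divisors.
by rewrite inE.
Qed.

(** The weights [h] are kept general because moving a mode through V_k
multiplies gamma by an affine function of |L|. *)
Definition s_series (h : Ninf -> F) p f : fps F :=
  fps_sum [set: Ninf]%classic
    (fun L => h L *: fps_mul (spow F L) (alpha (weight L + p).+1 f)).

Lemma s_seriesE h p f u (A : {fset Ninf}) : {subset divisors_of u.1 <= A} ->
  s_series h p f u = \sum_(L <- A)
    h L * fps_mul (spow F L) (alpha (weight L + p).+1 f) u.
Proof.
move=> sA; rewrite /s_series /fps_sum (fsbigTE A) // => L LA.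
rewrite fpsZE fps_mul_monom_eq0 ?mulr0 // => -[w wu].
move/negP: LA; apply; apply: sA; apply/in_divisors_of.
by exists w.1; rewrite -wu.
Qed.

Lemma s_series_is_linear h p : linear (s_series h p).
Proof.
move=> c f g; apply/funext => u; rewrite fpsDE fpsZE.
rewrite !(s_seriesE _ _ _ (fun _ => id)) mulr_sumr -big_split /=.
apply: eq_bigr => L _; rewrite !linearP /= fpsDE fpsZE.
by ring.
Qed.
HB.instance Definition _ h p :=
  GRing.isLinear.Build F (fps F) (fps F) _ (s_series h p)
    (s_series_is_linear h p).

(** The modes inside the series are derivations of index at least [p + 1], and
only [alpha 1] fails to commute with [t_0]; this is why [q = 0] requires
[p > 0]. *)
Lemma alpha_s_series q h p f : (0 < q + p)%N ->
  alpha q (s_series h p f) = s_series h p (alpha q f).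
Proof.
move=> qp; apply/funext => u; rewrite (s_seriesE _ _ _ (fun _ => id)).
have [c [v [uv Tu]]] := alpha_single_term q u.
rewrite Tu (s_seriesE _ _ _ (fun _ => id)) -uv mulr_sumr.
apply: eq_bigr => L _.
rewrite mulrCA -Tu alpha_spow alphaC andbF sub0r.
have -> : (q == 0%N) && ((weight L + p).+1 == 1%N) = false by lia.
by rewrite oppr0 scale0r addr0.
Qed.

(** At the monomial [u], both factors can be expanded over the divisors of
the s-part of [u] although the inner one is evaluated at a quotient of [u]: the
additional terms vanish.  The double sum is then symmetric. *)
Lemma s_seriesC h k p r f :
  s_series h p (s_series k r f) = s_series k r (s_series h p f).
Proof.
apply/funext => u; pose D := divisors_of u.1.
have double_sum h' k' p' r' :
    s_series h' p' (s_series k' r' f) u = \sum_(L <- D) \sum_(M <- D)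
    h' L * k' M * fps_mul (spow F L) (fps_mul (spow F M)
    (alpha (weight L + p').+1 (alpha (weight M + r').+1 f))) u.
  rewrite (s_seriesE _ _ _ (fun _ => id)); apply: eq_bigr => L _.
  rewrite alpha_s_series //.
  under [RHS]eq_bigr do rewrite -mulrA.
  rewrite -mulr_sumr; congr (_ * _).
  have [[w wu]|nLu] := pselect (exists w, monom_mul (L, mone) w = u);
      last first.
    rewrite fps_mul_monom_eq0 // big1 // => M _.
    by rewrite fps_mul_monom_eq0 ?mulr0.
  rewrite -{1}wu fps_mul_monomE (@s_seriesE _ _ _ _ D).
    by apply: eq_bigr => M _; rewrite -wu fps_mul_monomE alphaSC.
  move=> M /in_divisors_of [N MN]; apply/in_divisors_of; exists (mmul L N).
  by rewrite mulmA [mmul M L]mulmC -mulmA MN -wu.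
rewrite !double_sum exchange_big; apply: eq_bigr => L _; apply: eq_bigr => M _.
by rewrite fps_monom_mulC alphaSC; ring.
Qed.

(** * The sum over t_j *)

(** The factor [(0 < j + p)] discards the term [j = p = 0]: it encodes
d/dt_(-1) = 0, whereas [alpha 0] is multiplication by [t_0]. *)
Definition t_series p f : fps F :=
  fps_sum [set: nat]%classic
    (fun j => ((0 < j + p)%:R / (dfact (2 * j%:Z - 1))%:R)
       *: fps_mul (tvar F j) (alpha (j + p) f)).

Lemma t_seriesE p f u N : (forall j, j \in finsupp u.2 -> (j < N)%N) ->
  t_series p f u = \sum_(0 <= j < N) (0 < j + p)%:R / (dfact (2 * j%:Z - 1))%:R
    * fps_mul (tvar F j) (alpha (j + p) f) u.
Proof.
move=> uN; rewrite /t_series /fps_sum.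
rewrite -(@fsbig_widen _ _ _ _ [set` (index_iota 0 N)]%classic) //.
  by rewrite [RHS]fsbig_seq ?iota_uniq.
move=> j /= [_ /negP]; rewrite mem_index_iota /= => jN.
rewrite fpsZE fps_mul_monom_eq0 ?mulr0 // => -[w wu].
by move/negP: jN; apply; apply: uN; rewrite -cmE_neq0 -wu /= cmM cmUU.
Qed.

Lemma t_bounded u : exists N, forall M, (N <= M)%N ->
  forall j, j \in finsupp u.2 -> (j < M)%N.
Proof.
exists (\max_(j <- finsupp u.2) j).+1 => M NM j ju; apply: leq_trans NM.
by rewrite ltnS; apply: leq_bigmax_seq.
Qed.

Lemma t_series_is_linear p : linear (t_series p).
Proof.
move=> c f g; apply/funext => u; rewrite fpsDE fpsZE.
have [N /(_ N (leqnn _)) uN] := t_bounded u.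
rewrite !(t_seriesE _ _ uN) mulr_sumr -big_split /=.
by apply: eq_bigr => j _; rewrite !linearP /= fpsDE fpsZE; ring.
Qed.
HB.instance Definition _ p :=
  GRing.isLinear.Build F (fps F) (fps F) _ (t_series p) (t_series_is_linear p).

(** The correction consists of the brackets of [alpha q] with [t_j] and with
[alpha (j + p)]; it is stated for all large truncations [N] so that a chosen
index can be included in the range. *)
Lemma alpha_t_series q p f u : exists N0, forall N, (N0 <= N)%N ->
  alpha q (t_series p f) u = t_series p (alpha q f) u
  + \sum_(0 <= j < N) (0 < j + p)%:R / (dfact (2 * j%:Z - 1))%:R *
     (((q == j.+1)%:R * (dfact_nat (2 * j).+1)%:R) * alpha (j + p) f u
      - ((q == 0%N) && (j + p == 1)%N)%:R * fps_mul (tvar F j) f u).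
Proof.
have [c [v [uv Tu]]] := alpha_single_term q u.
have [N1 uN] := t_bounded u; have [N2 vN] := t_bounded v.
exists (maxn N1 N2) => N; rewrite geq_max => /andP[/uN {}uN /vN {}vN].
rewrite Tu (t_seriesE _ _ vN) (t_seriesE _ _ uN) mulr_sumr -big_split /=.
apply: eq_bigr => j _; rewrite mulrCA -Tu alpha_tvar fpsDE fpsZE.
have [jp|_] := ltnP 0 (j + p); last by rewrite !mul0r addr0.
rewrite alphaC linearD linearZ /= !fpsDE !fpsZE.
have -> : (q == 1%N) && (j + p == 0)%N = false by lia.
by rewrite /= sub0r; ring.
Qed.

(** * The Virasoro operators and their brackets with the modes *)

Definition quadratic p f : fps F := \sum_(1 <= i < p) alpha i (alpha (p - i) f).

Lemma quadratic_is_linear p : linear (quadratic p).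
Proof.
move=> c f g; rewrite /quadratic scaler_sumr -big_split.
by apply: eq_bigr => i _ /=; rewrite !linearP.
Qed.
HB.instance Definition _ p :=
  GRing.isLinear.Build F (fps F) (fps F) _ (quadratic p)
    (quadratic_is_linear p).

(** The terms of V_(p-1) in which no t_j occurs as a factor. *)
Definition vir_tfree p f : fps F :=
  - (2^-1 *: s_series (gamma F) p f) + 4^-1 *: quadratic p f
  + ((p == 1%N)%:R / 16) *: f.

Lemma vir_tfree_is_linear p : linear (vir_tfree p).
Proof.
move=> c f g; rewrite /vir_tfree !linearP /=; apply/funext => u.
by rewrite !(fpsDE, fpsZE, fpsNE); ring.
Qed.
HB.instance Definition _ p :=
  GRing.isLinear.Build F (fps F) (fps F) _ (vir_tfree p)
    (vir_tfree_is_linear p).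

Definition vir p f : fps F :=
  vir_tfree p f + 2^-1 *: t_series p f
  + ((p == 0%N)%:R / 4) *: alpha 0 (alpha 0 f).

Lemma vir_is_linear p : linear (vir p).
Proof.
move=> c f g; rewrite /vir !linearP /=; apply/funext => u.
by rewrite !(fpsDE, fpsZE, fpsNE); ring.
Qed.
HB.instance Definition _ p :=
  GRing.isLinear.Build F (fps F) (fps F) _ (vir p) (vir_is_linear p).

Hypothesis charF0 : [pchar F] =i pred0.

Lemma natS_neq0 n : (n.+1%:R != 0 :> F).
Proof. by rewrite (pcharf0P _).1. Qed.

Lemma dfact_odd i :
  dfact_nat (2 * i).+1 = ((2 * i).+1 * dfact (2 * i%:Z - 1))%N.
Proof.
case: i => [|i] //.
have -> : 2 * i.+1%:Z - 1 = ((2 * i).+1)%:Z by lia.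
by have -> : (2 * i.+1).+1 = (2 * i).+3 by lia.
Qed.

Lemma dfact_nat_gt0 n : (0 < dfact_nat n)%N.
Proof.
suff: ((0 < dfact_nat n) && (0 < dfact_nat n.+1))%N by case/andP.
by elim: n => // n /andP[n0 n1]; rewrite n1 /dfact_nat -/dfact_nat muln_gt0 n0.
Qed.

Lemma dfact_neq0 z : (dfact z)%:R != 0 :> F.
Proof.
suff: (0 < dfact z)%N by case: (dfact z) => // n _; exact: natS_neq0.
by case: z => // n; exact: dfact_nat_gt0.
Qed.

(** Only the term [j = i] contributes, through [d/dt_i (t_i) = 1]. *)
Lemma alphaS_t_series i p f :
  alpha i.+1 (t_series p f) = t_series p (alpha i.+1 f)
  + ((0 < i + p)%N%:R * (2 * i).+1%:R) *: alpha (i + p) f.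
Proof.
apply/funext => u.
have [N0 /(_ (maxn N0 i.+1) (leq_maxl _ _)) ->] := alpha_t_series i.+1 p f u.
rewrite fpsDE fpsZE; congr (_ + _).
rewrite (bigD1_seq i) ?iota_uniq //=; last by rewrite mem_index_iota; lia.
rewrite big1 => [|j ji].
  rewrite addr0 eqxx dfact_odd natrM.
  rewrite mul1r mul0r subr0.
  by move: (dfact_neq0 (2 * i%:Z - 1)) => d0; field.
by rewrite eqSS eq_sym (negbTE ji) !mul0r subr0 mulr0.
Qed.

(** Only the term [j = 0] can contribute, when [p = 1], through the bracket of
[t_0] with [alpha 1]. *)
Lemma alpha0_t_series p f : (0 < p)%N ->
  alpha 0 (t_series p f) = t_series p (alpha 0 f) - (p == 1%N)%:R *: alpha 0 f.
Proof.
move=> p0; apply/funext => u.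
have [N0 /(_ N0.+1 (leqnSn _)) ->] := alpha_t_series 0 p f u.
rewrite fpsDE fpsNE fpsZE; congr (_ + _).
rewrite big_nat_recl // big1 => [|j _].
  have -> : dfact (2 * 0%:Z - 1) = 1%N by [].
  rewrite addr0 add0n p0 [alpha 0 f]/alpha /= !mul0r sub0r.
  by rewrite divr1 mul1r.
have -> : (j.+1 + p == 1)%N = false by lia.
by rewrite !mul0r subr0 mulr0.
Qed.

Lemma alpha_quadratic q p f : alpha q (quadratic p f) = quadratic p (alpha q f)
  - (((q == 0%N) && (1 < p)%N)%:R * 2) *: alpha p.-1 f.
Proof.
rewrite /quadratic linear_sum.
have E i : (1 <= i < p)%N -> alpha q (alpha i (alpha (p - i) f)) =
   alpha i (alpha (p - i) (alpha q f)) -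
   (((q == 0%N) && (i == 1%N))%:R + ((q == 0%N) && (p - i == 1)%N)%:R)
     *: alpha p.-1 f.
  move=> /andP[i1 ip]; rewrite alphaC [alpha q (alpha (p - i) f)]alphaC.
  have -> : (i == 0%N) = false by lia.
  have -> : (p - i == 0)%N = false by lia.
  rewrite !andbF !sub0r linearD linearZ /= -addrA; congr (_ + _).
  rewrite scalerDl opprD !scaleNr [LHS]addrC; congr (- _ - _).
    by have [-> | _] := eqVneq i 1%N; rewrite ?subn1 // andbF !scale0r.
  have [pi|_] := eqVneq (p - i)%N 1%N; last by rewrite andbF !scale0r.
  by have -> : p.-1 = i by lia.
rewrite (eq_big_nat _ _ E) sumrB; congr (_ - _).
rewrite -scaler_suml big_split /=; congr (_ *: _).
have [_|_] /= := eqVneq q 0%N; last by rewrite !big1 // mul0r addr0.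
rewrite (@sum_rev_pos _ p (fun _ j => (j == 1%N)%:R)).
have [p1|p1] := ltnP 1 p; last by rewrite !big_geq // mul0r addr0.
rewrite big_ltn // eqxx big_nat_cond big1 ?addr0 ?mul1r // => i.
by case: i => [|[|i]].
Qed.

Lemma alphaS_vir_tfree q p f :
  alpha q.+1 (vir_tfree p f) = vir_tfree p (alpha q.+1 f).
Proof.
rewrite /vir_tfree !alphaE.
by rewrite alpha_s_series // alpha_quadratic /= mul0r scale0r subr0.
Qed.

(** The bracket comes from the coefficient t_(q-1) of [t_series] when [q > 0]
and [q + p > 1], from t_0^2/4 when [q = 1] and [p = 0], and, when [q = 0], from
[quadratic] for [p > 1] and from the derivation d/dt_0 in [t_series] for
[p = 1]. *)
Lemma alpha_vir q p f : (0 < q + p)%N -> alpha q (vir p f) =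
  vir p (alpha q f) + ((2 * q%:R - 1) / 2) *: alpha (q + p).-1 f.
Proof.
have nz2 := natS_neq0 1; have nz4 := natS_neq0 3.
case: q => [|i] qp; rewrite /vir.
  rewrite /vir_tfree !alphaE.
  rewrite add0n in qp *.
  rewrite alpha_s_series // alpha_quadratic alpha0_t_series //=.
  apply/funext => u; rewrite !(fpsDE, fpsZE, fpsNE).
  case: p qp => [|[|p]] //= _; field; by rewrite nz2 nz4 natS_neq0.
rewrite 2!alphaD !alphaZ alphaS_vir_tfree alphaS_t_series.
rewrite !(alphaS0, alphaD, alphaZ).
apply/funext => u; rewrite !(fpsDE, fpsZE, fpsNE) /=.
have [p0|p0] := posnP p.
  rewrite p0 addn0; case: i qp => [|i] _; rewrite ?addn0 /=.
    by field; rewrite nz2 nz4.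
  by field; rewrite nz2 nz4.
have -> : (0 < i + p)%N by lia.
by rewrite !mul0r mul1r !addr0 -!natr1 natrM; field; rewrite nz2.
Qed.

(** * Commutators at t = 0 *)

Lemma alpha0_t0 f (c : Ninf) : alpha 0 f (c, mone) = 0.
Proof.
apply: fps_mul_monom_eq0 => -[w] /(congr1 (fun m : monom => m.2 0%N)) /=.
by rewrite cmM cmUU cm1.
Qed.

Lemma vir_t0 p f (c : Ninf) : vir p f (c, mone) = vir_tfree p f (c, mone).
Proof.
rewrite /vir !fpsDE !fpsZE alpha0_t0 mulr0 addr0.
rewrite (@t_seriesE _ _ _ 0) ?big_geq //=.
  by rewrite mulr0 addr0.
by move=> j; rewrite mdom1 inE.
Qed.

Lemma spow_t0 L f g (c : Ninf) : (forall d : Ninf, f (d, mone) = g (d, mone)) ->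
  fps_mul (spow F L) f (c, mone) = fps_mul (spow F L) g (c, mone).
Proof.
move=> fg.
have [[[d b] [<- _]]|nLu] :=
  pselect (exists w, monom_mul (L, mone) w = (c, mone)).
  have -> : (mmul L d, mone) = monom_mul (L, mone) (d, mone) :> monom.
    by rewrite /monom_mul mul1m.
  by rewrite !fps_mul_monomE.
by rewrite !fps_mul_monom_eq0.
Qed.

Lemma quadratic_comm (T : {linear fps F -> fps F}) p f :
    (forall i g, T (alpha i.+1 g) = alpha i.+1 (T g)) ->
  T (quadratic p f) = quadratic p (T f).
Proof.
move=> Ta; rewrite /quadratic linear_sum; apply: eq_big_nat => i /andP[i1 ip].
case: i i1 ip => // i _ ip.
have [j ->] : exists j, (p - i.+1)%N = j.+1 by exists (p - i.+1).-1; lia.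
by rewrite !Ta.
Qed.

Lemma quadratic_s_series h p r f :
  quadratic p (s_series h r f) = s_series h r (quadratic p f).
Proof.
by rewrite (@quadratic_comm (s_series h r)) // => i g; rewrite alpha_s_series.
Qed.

Lemma quadraticC p r f :
  quadratic p (quadratic r f) = quadratic r (quadratic p f).
Proof.
rewrite (@quadratic_comm (quadratic p)) // => i g.
by rewrite alpha_quadratic mul0r scale0r subr0.
Qed.

Lemma vir_tfreeC p r f :
  vir_tfree p (vir_tfree r f) = vir_tfree r (vir_tfree p f).
Proof.
rewrite /vir_tfree !(linearD (s_series _ _)) !(linearD (quadratic _)).
rewrite !linearN !linearZ /=.
apply/funext => u; rewrite !(fpsDE, fpsZE, fpsNE).
rewrite (s_seriesC _ _ p r) (quadraticC p r) !quadratic_s_series.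
by ring.
Qed.

(** Each mode of the series is moved to the right of [vir r] by [alpha_vir];
then [vir r] stands on the left, where it can be replaced by [vir_tfree r]
because [t = 0]. *)
Lemma s_series_vir_t0 h p r f (c : Ninf) : (0 < p + r)%N ->
  s_series h p (vir r f) (c, mone) = s_series h p (vir_tfree r f) (c, mone)
  + s_series (fun L => h L * ((2 * (weight L + p).+1%:R - 1) / 2))
      (p + r).-1 f (c, mone).
Proof.
move=> pr; rewrite !(s_seriesE _ _ _ (fun _ => id)) -big_split.
apply: eq_bigr => L _ /=; rewrite -mulrA -mulrDr; congr (_ * _).
have -> : (weight L + (p + r).-1).+1 = ((weight L + p).+1 + r).-1 by lia.
rewrite alpha_vir // fps_mulD fps_mulZ fpsDE fpsZE; congr (_ + _).
by apply: spow_t0 => d; rewrite vir_t0 alphaS_vir_tfree.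
Qed.

Lemma quadratic_vir_t0 p r f (c : Ninf) :
  quadratic p (vir r f) (c, mone) = quadratic p (vir_tfree r f) (c, mone)
  + 2^-1 * shifted_convo (fun i j => alpha i (alpha j f) (c, mone)) p r.
Proof.
rewrite /quadratic /shifted_convo mulr_sumr !fct_sumE -big_split.
apply: eq_big_nat => i /andP[i1 ip] /=.
rewrite (@alpha_vir (p - i)%N r f); last by lia.
rewrite (alphaD i (vir r _)) alphaZ (@alpha_vir i r); last by lia.
case: i i1 ip => // i _ ip.
have [j ->] : exists j, (p - i.+1)%N = j.+1 by exists (p - i.+1).-1; lia.
by rewrite !fpsDE !fpsZE vir_t0 !alphaS_vir_tfree; ring.
Qed.

Lemma vir_tfreeE p f u : vir_tfree p f u = - (2^-1 * s_series (gamma F) p f u)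
  + 4^-1 * quadratic p f u + (p == 1%N)%:R / 16 * f u.
Proof. by []. Qed.

Lemma vir_tfree_vir_t0 p r f (c : Ninf) : (0 < p + r)%N ->
  vir_tfree p (vir r f) (c, mone) = vir_tfree p (vir_tfree r f) (c, mone)
  - 2^-1 * s_series (fun L => gamma F L * ((2 * (weight L + p).+1%:R - 1) / 2))
            (p + r).-1 f (c, mone)
  + 4^-1 * (2^-1 *
      shifted_convo (fun i j => alpha i (alpha j f) (c, mone)) p r).
Proof.
move=> pr; rewrite !(vir_tfreeE p) s_series_vir_t0 // quadratic_vir_t0 vir_t0.
by ring.
Qed.

Lemma shifted_convo_alpha p r f (c : Ninf) : (r < p)%N ->
  let G i j := alpha i (alpha j f) (c, mone) in
  shifted_convo G p r - shifted_convo G r p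
  = 2 * (p%:R - r%:R) * quadratic (p + r).-1 f (c, mone)
    + ((p == 2%N) && (r == 0%N))%:R * f (c, mone).
Proof.
move=> rp G.
have -> : quadratic (p + r).-1 f (c, mone) = convo G (p + r).-1.
  by rewrite /quadratic fct_sumE.
have G_sym i j : (0 < i)%N -> (0 < j)%N -> G i j = G j i.
  by case: i j => [|i] [|j] // _ _; rewrite /G alphaSC.
have [->|r0] := posnP r; last first.
  by rewrite shifted_convo_antisym ?andbF ?mul0r ?addr0 //; lia.
rewrite andbT [shifted_convo G 0 p]big_geq // !subr0 addn0.
apply: shifted_convo0 => [|j|[//|i] _]; first by lia.
  exact: alpha0_t0.
by rewrite /G alphaS0 fpsDE fpsZE alpha0_t0 add0r.
Qed.

Lemma vir_comm_t0 p r f (c : Ninf) : (r < p)%N ->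
  (vir p (vir r f) - vir r (vir p f)) (c, mone)
  = (p%:R - r%:R) * vir (p + r).-1 f (c, mone).
Proof.
move=> rp; have pr : (0 < p + r)%N by lia.
have s_diff :
          s_series (fun L => gamma F L * ((2 * (weight L + p).+1%:R - 1) / 2))
            (p + r).-1 f (c, mone)
        - s_series (fun L => gamma F L * ((2 * (weight L + r).+1%:R - 1) / 2))
            (p + r).-1 f (c, mone)
        = (p%:R - r%:R) * s_series (gamma F) (p + r).-1 f (c, mone).
  rewrite !(s_seriesE _ _ _ (fun _ => id)) -sumrB mulr_sumr.
  by apply: eq_bigr => L _; rewrite -!natr1 !natrD; field; exact: natS_neq0.
have convo_diff := shifted_convo_alpha f c rp.
have Vpr := vir_tfree_vir_t0 f c pr.
have := vir_tfree_vir_t0 (p := r) (r := p) f c.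
rewrite [(r + p)%N]addnC => /(_ pr) Vrp.
rewrite fpsDE fpsNE !vir_t0 Vpr Vrp (vir_tfreeC r p) (vir_tfreeE (p + r).-1).
have nz2 := natS_neq0 1; have nz4 := natS_neq0 3; have nz16 := natS_neq0 15.
(* As r < p, the constant 1/16 occurs on the right only for [V_1, V_(-1)]. *)
have -> : ((p + r).-1 == 1)%N = (p == 2%N) && (r == 0%N) by lia.
set S := shifted_convo _ p r in convo_diff *.
set S' := shifted_convo _ r p in convo_diff *.
set W := s_series _ _ _ _ in s_diff *.
set W' := s_series _ _ _ _ in s_diff *.
transitivity (- (2^-1 * (W - W')) + 4^-1 * (2^-1 * (S - S'))); first by ring.
rewrite s_diff convo_diff.
case: andP => [[/eqP -> /eqP ->]|_];
  rewrite ?(mulr0n, mulr1n) ?mul0r ?mul1r.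
  by field; rewrite nz2 nz4 nz16.
by field; rewrite nz2 nz4.
Qed.

(** * From t = 0 to all coefficients *)

Lemma virD p f g : vir p (f + g) = vir p f + vir p g.
Proof. exact: linearD. Qed.

Lemma virZ p (c : F) f : vir p (c *: f) = c *: vir p f.
Proof. exact: linearZ. Qed.

Definition defect p r f : fps F :=
  vir p (vir r f) - vir r (vir p f) - (p%:R - r%:R : F) *: vir (p + r).-1 f.

(** This is the Jacobi identity with the brackets of [alpha_vir]. *)
Lemma alphaS_defect p r q f : (0 < p + r)%N ->
  alpha q.+1 (defect p r f) = defect p r (alpha q.+1 f).
Proof.
move=> pr; have nz2 := natS_neq0 1.
have E k l : (0 < k + l)%N -> alpha q.+1 (vir k (vir l f)) =
    vir k (vir l (alpha q.+1 f))
    + ((2 * q.+1%:R - 1) / 2) *: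
      (vir k (alpha (q + l) f) + vir l (alpha (q + k) f)
       + ((2 * (q + k)%:R - 1) / 2) *: alpha (q + (k + l).-1) f).
  move=> kl; rewrite (@alpha_vir q.+1 k (vir l f)) // (@alpha_vir q.+1 l f) //.
  rewrite virD (virZ k _ (alpha _ _)).
  rewrite addSn addSn /=.
  rewrite (@alpha_vir (q + k)%N l f); last by lia.
  have -> : (q + k + l).-1 = (q + (k + l).-1)%N by lia.
  by apply/funext => u; rewrite !(fpsDE, fpsZE); ring.
have rp : (0 < r + p)%N by rewrite addnC.
rewrite /defect 2!alphaD !alphaN alphaZ (E p r) // (E r p) //.
rewrite (@alpha_vir q.+1 (p + r).-1) // addSn /= [(r + p)%N]addnC.
apply/funext => u; rewrite !(fpsDE, fpsNE, fpsZE) !natrD -!natr1.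
by field; rewrite nz2.
Qed.

(** Induction on the degree in [t]: if [t_j] divides the monomial, the
coefficient is a nonzero multiple of one of smaller degree in the derivative of
[defect p r f] by [t_j], which is the defect of a derivative of [f]. *)
Lemma defect_eq0 p r f : (r < p)%N -> defect p r f = 0.
Proof.
move=> rp; apply/funext => -[c b].
have [n] := ubnP (mdeg b); elim: n b f => // n IH b f bn.
have [->|b1] := eqVneq b mone.
  by rewrite /defect fpsDE fpsNE fpsZE vir_comm_t0 // subrr.
have [j bj] : exists j, b j != 0%N.
  apply: contra_neqP b1 => nb; apply: cmonomP => j; rewrite cm1; apply/eqP.
  by apply: contra_notT nb => bj; exists j.
have [b' bE] : exists b', mmul b' (ucm j) = b.
  exists (divcm b (ucm j)); apply: cmonomP => k; rewrite cmM divcmE cmU.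
  by have [<-|_] := eqVneq j k; [rewrite subnK // lt0n|rewrite subn0 addn0].
have := IH b' (alpha j.+1 f).
rewrite -alphaS_defect; last by lia.
rewrite [alpha j.+1]/alpha fpsZE /partial_t_nat /monom_mul /= mulm1 bE.
have b'n : (mdeg b' < n)%N.
  by move: bn; rewrite -bE mdegM mdegU; lia.
move=> /(_ b'n)/eqP; rewrite !mulf_eq0 (negbTE (natS_neq0 _)).
have -> : ((dfact_nat (2 * j).+1)%:R == 0 :> F) = false.
  by apply/negbTE; exact: (dfact_neq0 (Posz _)).
by move=> /eqP.
Qed.

(** * Identification with V *)

Lemma V_vir p f : V F (p%:Z - 1) f = vir p f.
Proof.
have Q : fps_sum [set d : nat * nat |
      d.1%:Z + d.2%:Z = (p%:Z - 1) - 1]%classic (fun d =>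
       (dfact (2 * d.1%:Z + 1) * dfact (2 * d.2%:Z + 1))%:R
         *: partial_t d.1%:Z (partial_t d.2%:Z f)) = quadratic p f.
  apply/funext => u; rewrite /quadratic fct_sumE /fps_sum.
  rewrite (@fsbig_fwiden _ _ _ _ [seq (i, p - i.+2)%N | i <- index_iota 0 p.-1]).
  - rewrite big_map big_add1; apply: eq_big_nat => i /andP[_ ip].
    have -> : (p - i.+1 = (p - i.+2).+1)%N by lia.
    have D k : dfact (2 * k%:Z + 1) = dfact_nat (2 * k).+1.
      by have -> : 2 * k%:Z + 1 = (2 * k).+1%:Z by lia.
    cbn [fst snd]; rewrite !D.
    by rewrite natrM fpsZE /alpha fpsZE partial_tZ fpsZE mulrA.
  - move=> [i j] /= ij; apply/mapP; exists i; last by congr pair; lia.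
    by rewrite mem_index_iota; lia.
  - by rewrite map_inj_uniq ?iota_uniq // => i j [].
  - move=> [i j] /= [/mapP [k]]; rewrite mem_index_iota => kp [-> ->].
    by case; lia.
rewrite /V Q /vir /vir_tfree.
have -> : (p%:Z - 1 == -1) = (p == 0%N) by lia.
have -> : (p%:Z - 1 == 0) = (p == 1%N) by lia.
have -> : fps_mul (fps_mul (tvar F 0) (tvar F 0)) f = alpha 0 (alpha 0 f).
  pose t0 : monom := (mone, ucm 0%N).
  by rewrite /tvar (fps_monomM F t0 t0) -(fps_monom_mulA t0 t0 f).
have -> : fps_sum setT (fun L =>
     ((dfact (2 * ((weight L)%:Z + (p%:Z - 1)) + 3))%:R * gamma F L)
       *: fps_mul (spow F L) (partial_t ((weight L)%:Z + (p%:Z - 1) + 1) f))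
   = s_series (gamma F) p f.
  rewrite /s_series; congr fps_sum; apply/funext => L.
  have -> : 2 * ((weight L)%:Z + (p%:Z - 1)) + 3 = (2 * (weight L + p)).+1%:Z by lia.
  have -> : (weight L)%:Z + (p%:Z - 1) + 1 = (weight L + p)%:Z by lia.
  by rewrite /alpha fps_mulZ scalerA mulrC.
have -> : fps_sum setT (fun j : nat =>
     ((dfact (2 * (j%:Z + (p%:Z - 1)) + 1))%:R / (dfact (2 * j%:Z - 1))%:R)
         *: fps_mul (tvar F j) (partial_t (j%:Z + (p%:Z - 1)) f)) = t_series p f.
  rewrite /t_series; congr fps_sum; apply/funext => j.
  case jp : (j + p)%N => [|q].
    have -> : j%:Z + (p%:Z - 1) = -1 by lia.
    by rewrite mul0r scale0r /= linear0 scaler0.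
  have -> : 2 * (j%:Z + (p%:Z - 1)) + 1 = (2 * q).+1%:Z by lia.
  have -> : j%:Z + (p%:Z - 1) = q%:Z by lia.
  by rewrite /alpha fps_mulZ scalerA mul1r mulrC.
by apply/funext => u; rewrite !(fpsDE, fpsNE, fpsZE); ring.
Qed.

End Virasoro.

Theorem theorem4p3 (F : fieldType) (charF0 : [pchar F] =i pred0)
    (n m : int) (n_ge : -1 <= n) (m_ge : -1 <= m) :
  (V F n \o V F m) - (V F m \o V F n) = (n - m)%:~R *: V F (n + m).
Proof.
have shift k : -1 <= k -> exists p : nat, k = p%:Z - 1.
  by move=> k_ge; exists (absz (k + 1)); lia.
have [p ->] := shift n n_ge; have [r ->] := shift m m_ge.
have -> : (p%:Z - 1) - (r%:Z - 1) = p%:Z - r%:Z by ring.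
apply/funext => f; change (V F (p%:Z - 1) (V F (r%:Z - 1) f)
  - V F (r%:Z - 1) (V F (p%:Z - 1) f)
  = (p%:Z - r%:Z)%:~R *: V F (p%:Z - 1 + (r%:Z - 1)) f).
rewrite !V_vir rmorphB /=.
(* defect_eq0 wants the larger index first; for n = m both sides are 0. *)
have [rp|pr|->] := ltngtP r p; last by rewrite !subrr scale0r.
  have -> : p%:Z - 1 + (r%:Z - 1) = (p + r).-1%:Z - 1 by lia.
  by rewrite V_vir; apply/eqP; rewrite -subr_eq0; apply/eqP/defect_eq0.
have -> : p%:Z - 1 + (r%:Z - 1) = (r + p).-1%:Z - 1 by lia.
rewrite V_vir -[LHS]opprB -[X in X *: _]opprB scaleNr; congr (- _).
by apply/eqP; rewrite -subr_eq0; apply/eqP/defect_eq0.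
Qed.
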